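(* Let $p=3$ and $q=p^m$, where $m\ge 6$ is an even integer, and let $\pi$ be a primitive element of $\mathbb{F}_q$. The cyclic code $\mathcal{C}$ over $\mathbb{F}_3$ of length $q-1$ with nonzeros $\pi^{-2},\pi^{-(p+1)},\pi^{-(p^2+1)}$ has seven nonzero weights, and, writing $A_w$ for the number of codewords of $\mathcal{C}$ of Hamming weight $w$, these weights and their frequencies are $$A_{p^{m-1}(p-1)}=2(n_1+n_3),$$ $$A_{p^{m-1}(p-1)-\frac{p-1}{p}p^{m/2}}=n_{1,0},\qquad A_{p^{m-1}(p-1)+\frac{p-1}{p}p^{m/2}}=n_{-1,0},$$ $$A_{p^{m-1}(p-1)-\frac{p-1}{p}p^{(m+2)/2}}=n_{1,2},\qquad A_{p^{m-1}(p-1)+\frac{p-1}{p}p^{(m+2)/2}}=n_{-1,2},$$ $$A_{p^{m-1}(p-1)-\frac{p-1}{p}p^{(m+4)/2}}=n_{1,4},\qquad A_{p^{m-1}(p-1)+\frac{p-1}{p}p^{(m+4)/2}}=n_{-1,4}.$$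
   Context: Let $\mathrm{Tr}:\mathbb{F}_q\to\mathbb{F}_p$ be the trace map and $\zeta_p=e^{2\pi i/p}$. The cyclic code $\mathcal{C}$ over $\mathbb{F}_p$ of length $l=q-1$ with nonzeros $\pi^{-2},\pi^{-(p+1)},\pi^{-(p^2+1)}$ consists of the codewords $c(\alpha,\beta,\gamma)=(c_0,\dots,c_{l-1})$, $\alpha,\beta,\gamma\in\mathbb{F}_q$, with $c_i=\mathrm{Tr}(\alpha\pi^{2i}+\beta\pi^{(p+1)i}+\gamma\pi^{(p^2+1)i})$ for $0\le i\le l-1$. For $\alpha,\beta,\gamma\in\mathbb{F}_q$ put $S(\alpha,\beta,\gamma)=\sum_{x\in\mathbb{F}_q}\zeta_p^{\mathrm{Tr}(\alpha x^2+\beta x^{p+1}+\gamma x^{p^2+1})}$. For $\varepsilon=\pm1$, let $n_{\varepsilon,j}$ be the number of $(\alpha,\beta,\gamma)\in\mathbb{F}_q^3\setminus\{(0,0,0)\}$ with $S(\alpha,\beta,\gamma)=\varepsilon p^{(m+j)/2}$ if $j\in\{0,2,4\}$, and with $S(\alpha,\beta,\gamma)=\varepsilon\, i\, p^{(m+j)/2}$ ($i$ the imaginary unit) if $j\in\{1,3\}$. For $j\in\{1,3\}$ one has $n_{1,j}=n_{-1,j}$, and this common value is denoted $n_j$. *)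

(* Defs.v *)
From HB Require Import structures.
From mathcomp Require Import all_boot all_order all_algebra all_fingroup.
From mathcomp Require Import all_solvable all_field.
From mathcomp Require Import zify.
From mathcomp Require Import complex reals exp trigo.

Set Implicit Arguments.
Unset Strict Implicit.
Unset Printing Implicit Defensive.
Import Order.TTheory GRing.Theory Num.Theory.

Lemma cyclotomic_cosets3 (m e e' j : nat) : 5 < m ->
  e \in [:: 2; 4; 10] -> e' \in [:: 2; 4; 10] -> j < m ->
  e * 3 ^ j = e' %[mod (3 ^ m).-1] -> e = e' /\ j = 0.
Proof.
move=> m5 eE e'E jm.
have [k mk] : exists k, m = k + 6 by exists (m - 6); rewrite subnK.
set N := (3 ^ m).-1; have k0 : 0 < 3 ^ k by rewrite expn_gt0.
have NE : N = 729 * 3 ^ k - 1 by rewrite /N mk expnD mulnC subn1.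
have {}e'E : [\/ e' = 2, e' = 4 | e' = 10].
  by move: e'E; rewrite !inE => /or3P[] /eqP ->; [constructor 1|constructor 2|constructor 3].
have {}eE : [\/ e = 2, e = 4 | e = 10].
  by move: eE; rewrite !inE => /or3P[] /eqP ->; [constructor 1|constructor 2|constructor 3].
have red q r : r < N -> e * 3 ^ j = q * N + r ->
    e * 3 ^ j = e' %[mod N] -> r = e'.
  move=> rN ->; rewrite modnMDl !modn_small //.
  by case: e'E => ->; lia.
have j3 : [\/ j <= k + 3, j = k + 4 | j = k + 5].
  by case: (leqP j (k + 3)) => ?; [constructor 1|case: (eqVneq j (k + 4)) => ?; [constructor 2|constructor 3; lia]].
case: j3 => [jk|jk|jk].
- have U : 3 ^ j <= 27 * 3 ^ k by rewrite mulnC -(expnD 3 k 3) leq_exp2l.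
  move=> /(red 0 (e * 3 ^ j)) H.
  have {H} : e * 3 ^ j = e' by apply: H => //; case: eE => ->; lia.
  case: j {U red jk jm} => [|j]; first by rewrite expn0 muln1.
  rewrite expnS; move: (3 ^ j) => u; case: eE => ->; case: e'E => ->; lia.
- have U : 3 ^ j = 81 * 3 ^ k by rewrite jk expnD mulnC.
  case: eE => eE.
  + move=> /(red 0 (162 * 3 ^ k)) H; have : 162 * 3 ^ k = e' by apply: H; rewrite ?eE ?U; lia.
    by case: e'E => ->; lia.
  + move=> /(red 0 (324 * 3 ^ k)) H; have : 324 * 3 ^ k = e' by apply: H; rewrite ?eE ?U; lia.
    by case: e'E => ->; lia.
  + move=> /(red 1 (81 * 3 ^ k + 1)) H; have : 81 * 3 ^ k + 1 = e' by apply: H; rewrite ?eE ?U; lia.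
    by case: e'E => ->; lia.
- have U : 3 ^ j = 243 * 3 ^ k by rewrite jk expnD mulnC.
  case: eE => eE.
  + move=> /(red 0 (486 * 3 ^ k)) H; have : 486 * 3 ^ k = e' by apply: H; rewrite ?eE ?U; lia.
    by case: e'E => ->; lia.
  + move=> /(red 1 (243 * 3 ^ k + 1)) H; have : 243 * 3 ^ k + 1 = e' by apply: H; rewrite ?eE ?U; lia.
    by case: e'E => ->; lia.
  + move=> /(red 3 (243 * 3 ^ k + 3)) H; have : 243 * 3 ^ k + 3 = e' by apply: H; rewrite ?eE ?U; lia.
    by case: e'E => ->; lia.
Qed.

Local Open Scope ring_scope.

Section FiniteField.
Variables (p : nat) (F : finFieldType) (pcharF : p \in [pchar F]).

(* F with its structure of (Galois) extension of the prime field 'F_p. *)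
Local Notation L := (pPrimeCharType pcharF).

(* galTrace lies in 1%VS, the line spanned by 1; coord reads it in 'F_p. *)
Definition trace (x : F) : 'F_p :=
  coord [tuple (1 : L)] ord0 (galTrace 1%AS {:L}%AS (x : L)).

Definition codeword_poly (v : 'rV['F_p]_(#|F|.-1)) : {poly F} :=
  map_poly (in_alg L) (rVpoly v).

(* Every x != 0 in F is a (#|F|.-1)-th root of unity; the nonzeros of a cyclic
   code over 'F_p are closed under conjugation, i.e. under y |-> y ^+ p. *)
Definition cyclic_code (nonzeros : seq F) : {set 'rV['F_p]_(#|F|.-1)} :=
  [set v | [forall x : F,
     (x != 0) && ~~ has (fun z => fconnect (fun y : F => y ^+ p) z x) nonzeros
       ==> root (codeword_poly v) x]].

Definition trace_codeword (g a b c : F) : 'rV['F_p]_(#|F|.-1) :=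
  \row_i trace (a * g ^+ (2 * i) + b * g ^+ ((p + 1) * i)
                  + c * g ^+ ((p ^ 2 + 1) * i)).

Definition exp_sum (R : realType) (t : F * F * F) : R[i] :=
  let: (a, b, c) := t in
  let zeta : R[i] := (cos (2 * pi / p%:R) +i* sin (2 * pi / p%:R))%C in
  \sum_(x : F)
    zeta ^+ (trace (a * x ^+ 2 + b * x ^+ (p + 1) + c * x ^+ (p ^ 2 + 1)) : nat).

(* n_{eps, j}, for #|F| = p ^ m with m even. *)
Definition num_exp_sum (R : realType) (m : nat) (eps : int) (j : nat) : nat :=
  #|[set t : F * F * F | (t != (0, 0, 0)) &&
      (exp_sum R t == eps%:~R * (if odd j then 'i%C else 1)
                        * (p%:R `^ ((m + j)%:R / 2))%:C%C)]|.

Lemma in_algE (a : 'F_p) : in_alg L a = (a : nat)%:R :> F.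
Proof. by rewrite -[LHS]/((a : nat)%:R * 1 : F) mulr1. Qed.

Lemma in_alg_trace (x : F) :
  in_alg L (trace x) = galTrace 1%AS {:L}%AS (x : L).
Proof.
have s1L : (1%AS <= {:L}%AS)%VS by exact: sub1v.
have galL := finField_galois s1L.
have gT : galTrace 1%AS {:L}%AS (x : L) \in <<[tuple (1%R : L)]>>%VS.
  by rewrite span_seq1; apply: mem_galTrace galL _; apply: memvf.
by rewrite [RHS](coord_span gT) big_ord_recl big_ord0 addr0.
Qed.

Lemma traceE (m : nat) (cardF : #|F| = (p ^ m)%N) (x : F) :
  (trace x : nat)%:R = \sum_(i < m) x ^+ (p ^ i) :> F.
Proof.
have p_pr := pcharf_prime pcharF.
have s1L : (1%AS <= {:L}%AS)%VS by exact: sub1v.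
have galL := finField_galois s1L.
rewrite -in_algE in_alg_trace.
have [a gena aE] := finField_galois_generator s1L.
have oa : #[a]%g = m.
  rewrite orderE -(eqP gena) -galois_dim // dimv1 divn1 pprimeChar_dimf.
  by rewrite (_ : #|_| = p ^ m)%N ?pfactorK.
pose s := [seq (a ^+ i)%g | i <- iota 0 m].
have us : uniq s.
  rewrite map_inj_in_uniq ?iota_uniq // => i j; rewrite !mem_iota !add0n /=.
  move=> im jm /eqP; rewrite eq_expg_mod_order oa.
  by rewrite !modn_small // => /eqP.
have sP : <[a]>%g =i s.
  move=> y; apply/idP/mapP => [ya | [i _ ->]]; last exact: mem_cycle.
  have [i im ->] := cyclePmin ya; rewrite oa in im.
  by exists i => //; rewrite mem_iota add0n.
have aiE i : (a ^+ i)%g (x : L) = x ^+ (p ^ i) :> F.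
  elim: i => [|i IHi]; first by rewrite expg0 gal_id.
  rewrite expgSr galM ?memvf // aE ?memvf // dimv1 expn1 card_Fp // IHi.
  by rewrite -exprM expnSr.
rewrite /galTrace (eqP gena) (eq_bigl _ _ sP) -big_uniq //= big_map -val_enum_ord.
by rewrite big_map big_enum; apply: eq_bigr => i _; rewrite aiE.
Qed.

Lemma traceN (x : F) : trace (- x) = - trace x.
Proof. by rewrite /trace raddfN linearN. Qed.

Lemma num_exp_sum_odd (R : realType) (m : nat) (eps : int) (j : nat) :
  odd j -> num_exp_sum R m eps j = num_exp_sum R m (- eps) j.
Proof.
have p_pr := pcharf_prime pcharF.
move=> oj; rewrite /num_exp_sum oj.
set r := (_ `^ _)%:C%C.
pose N (t : F * F * F) : F * F * F := (- t.1.1, - t.1.2, - t.2).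
have NK : involutive N by case=> [[a b] c]; rewrite /N /= !opprK.
have SN t : exp_sum R (N t) = ((exp_sum R t)^*)%C.
  case: t => [[a b] c]; rewrite /exp_sum /= rmorph_sum; apply: eq_bigr => x _.
  set th := 2 * pi / p%:R; set z := (_ +i* _)%C.
  have zk k : z ^+ k = (cos (th *+ k) +i* sin (th *+ k))%C.
    elim: k => [|k IHk]; first by rewrite mulr0n cos0 sin0.
    rewrite exprSr IHk mulrSr cosD sinD /z.
    by apply/eqP; rewrite eq_complex /= eqxx addrC eqxx.
  have zp : z ^+ p = 1.
    rewrite zk /th -[_ *+ p]mulr_natr divfK ?pnatr_eq0 -?lt0n ?prime_gt0 //.
    by rewrite mulr_natl cos2pi sin2pi.
  have zJ : z * z^*%C = 1.
    apply/eqP; rewrite eq_complex /= !mulrN opprK -!expr2 cos2Dsin2 eqxx /=.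
    by rewrite mulrC addNr.
  have zJk k : z ^+ k * (z ^+ k)^*%C = 1 by rewrite rmorphXn -exprMn zJ expr1n.
  rewrite !mulNr -!opprD traceN; set u := trace _.
  rewrite -[LHS]mul1r -(zJk u) mulrAC -exprD.
  have -> : z ^+ (u + (- u)%R) = 1.
    apply: expr_dvd zp _; rewrite -[X in (X %| _)%N](Fp_cast p_pr) /dvdn.
    by have /(congr1 val) /= -> := addrN u.
  by rewrite mul1r.
have -> : [set t : F * F * F | (t != (0, 0, 0)) && (exp_sum R t == eps%:~R * 'i%C * r)]
  = N @^-1: [set t : F * F * F | (t != (0, 0, 0)) && (exp_sum R t == (- eps)%:~R * 'i%C * r)].
  apply/setP => t; rewrite !inE SN; case: t => [[a b] c].
  rewrite /N /= !xpair_eqE !oppr_eq0; congr andb.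
  have rJ : (((- eps)%:~R * 'i * r)^*)%C = eps%:~R * 'i%C * r :> R[i].
    have eJ : (((- eps)%:~R : R[i])^*)%C = - eps%:~R by rewrite rmorph_int rmorphN.
    have iJ : (('i : R[i])^*)%C = - 'i%C.
      by apply/eqP; rewrite eq_complex /= oppr0 !eqxx.
    transitivity (- eps%:~R * - 'i%C * r : R[i]); last by rewrite mulrNN.
    rewrite !rmorphM; congr (_ * _ * _); [exact: eJ | exact: iJ |].
    exact: conjc_real.
  by rewrite -[RHS](inj_eq (can_inj (@conjcK R))) conjcK rJ.
by rewrite card_preimset //; apply: can_inj NK.
Qed.

Lemma expf_card_pred (y : F) : y != 0 -> y ^+ #|F|.-1 = 1.
Proof.
move=> y0; apply: (mulfI y0); rewrite -exprS prednK ?expf_card ?mulr1 //.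
exact: ltnW (finNzRing_gt1 F).
Qed.

Lemma geom_root (y : F) : y != 0 ->
  \sum_(i < #|F|.-1) y ^+ i = - (y == 1)%:R.
Proof.
move=> y0; have [->|y1] := eqVneq y 1.
  rewrite (eq_bigr (fun=> 1)) => [|i _]; last by rewrite expr1n.
  rewrite sumr_const card_ord; apply/eqP.
  rewrite -addr_eq0 -mulrSr prednK ?(ltnW (finNzRing_gt1 F)) //.
  rewrite (_ : #|F| = #|L|) // (card_pprimeChar pcharF) natrX pcharf0 //.
  rewrite expr0n; case: logn (card_pprimeChar pcharF) => // cF.
  by have := finNzRing_gt1 F; rewrite (_ : #|F| = #|L|) // cF.
rewrite oppr0; apply: (mulfI (x := y - 1)); first by rewrite subr_eq0.
by rewrite -subrX1 expf_card_pred // subrr mulr0.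
Qed.

Lemma horner_codeword (v : 'rV['F_p]_(#|F|.-1)) (x : F) :
  (codeword_poly v).[x] = \sum_i (v 0 i : nat)%:R * x ^+ i.
Proof.
rewrite /codeword_poly /rVpoly poly_def.
rewrite (rmorph_sum (map_poly (in_alg L))) /= -[LHS]/(horner (R := L) _ _).
rewrite horner_sum; apply: eq_bigr => i _; rewrite valK.
rewrite map_polyZ map_polyXn /= hornerZ hornerXn; congr (_ * _); exact: in_algE.
Qed.

Lemma codeword_polyXp v x :
  (codeword_poly v).[x ^+ p] = (codeword_poly v).[x] ^+ p.
Proof.
rewrite !horner_codeword -[RHS]/(pFrobenius_aut pcharF _) rmorph_sum.
apply: eq_bigr => i _; rewrite rmorphM rmorph_nat; congr (_ * _).
by rewrite -[RHS]/((x ^+ i) ^+ p) -!exprM mulnC.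
Qed.

Lemma codeword_poly0 v : (forall x, x != 0 -> root (codeword_poly v) x) -> v = 0.
Proof.
move=> v0; apply: (can_inj rVpolyK); rewrite linear0.
apply: (@map_poly_inj _ _ (in_alg L)); rewrite rmorph0.
apply: contraTeq isT => nz.
have r0 : all (root (codeword_poly v)) (enum [set~ (0 : F)]).
  by apply/allP => x; rewrite mem_enum !inE => /v0.
have := max_poly_roots nz r0 (enum_uniq _).
by rewrite -cardE cardsC1 size_map_poly ltnNge size_poly.
Qed.

Section Delsarte.
Variables (m : nat) (cardF : #|F| = (p ^ m)%N) (m_gt0 : (0 < m)%N).
Variables (g : F) (g_prim : (#|F|.-1).-primitive_root g).

Let E := [:: 2; p + 1; p ^ 2 + 1]%N.
Hypothesis sepE : forall e e' j, e \in E -> e' \in E -> (j < m)%N ->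
  (e * p ^ j = e' %[mod #|F|.-1])%N -> e = e' /\ j = 0%N.

Let g0 : g != 0.
Proof.
apply: contra_eqN (prim_expr_order g_prim) => /eqP->.
by rewrite expr0n gtn_eqF ?(prim_order_gt0 g_prim) // eq_sym oner_neq0.
Qed.

Lemma horner_trace_codeword a b c x : x != 0 ->
  (codeword_poly (trace_codeword g a b c)).[x] = - \sum_(j < m)
   (a ^+ (p ^ j) * (g ^+ (2 * p ^ j) * x == 1)%:R +
    b ^+ (p ^ j) * (g ^+ ((p + 1) * p ^ j) * x == 1)%:R +
    c ^+ (p ^ j) * (g ^+ ((p ^ 2 + 1) * p ^ j) * x == 1)%:R).
Proof.
move=> x0; rewrite horner_codeword.
have key e j : \sum_(i < #|F|.-1) (g ^+ (e * i)) ^+ (p ^ j) * x ^+ i =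
    - (g ^+ (e * p ^ j) * x == 1)%:R.
  rewrite -geom_root ?mulf_neq0 ?expf_neq0 //.
  by apply: eq_bigr => i _; rewrite exprMn -!exprM mulnAC.
under eq_bigr => i _ do rewrite mxE (traceE cardF) mulr_suml.
rewrite exchange_big /= -sumrN; apply: eq_bigr => j _.
have pj : [pchar F].-nat (p ^ j)%N.
  by rewrite pnatX (pnatE _ (pcharf_prime pcharF)) pcharF.
rewrite !opprD -!mulrN -!key !mulr_sumr -!big_split; apply: eq_bigr => i _ /=.
by rewrite !(exprDn_pchar _ _ pj) !mulrDl ![(_ * g ^+ _) ^+ _]exprMn -!mulrA.
Qed.

Let Frob := fun y : F => y ^+ p.

Let iter_Frob j z : iter j Frob z = z ^+ (p ^ j).
Proof. by elim: j => // j IHj; rewrite iterS IHj /Frob -exprM expnSr. Qed.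

Let conjP e j x : x != 0 -> g ^+ (e * p ^ j) * x = 1 -> fconnect Frob (g ^- e) x.
Proof.
move=> x0 gx; have -> : x = iter j Frob (g ^- e); last exact: fconnect_iter.
by rewrite iter_Frob exprVn -exprM -[RHS]mulr1 -gx mulKf ?expf_neq0.
Qed.

Let horner_nonzero a b c e : e \in E ->
  (codeword_poly (trace_codeword g a b c)).[g ^- e] =
   - (a * (e == 2)%:R + b * (e == p + 1)%N%:R + c * (e == p ^ 2 + 1)%N%:R).
Proof.
move=> eE; rewrite horner_trace_codeword ?invr_eq0 ?expf_neq0 //; congr (- _).
have gE e' j : e' \in E -> (j < m)%N ->
    (g ^+ (e' * p ^ j) * g ^- e == 1) = (e == e') && (j == 0%N).
  move=> e'E jm; rewrite -(inj_eq (mulIf (expf_neq0 e g0))) mulfVK ?expf_neq0 //.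
  rewrite mul1r (eq_prim_root_expr g_prim).
  apply/eqP/andP => [/(sepE e'E eE jm)[-> ->] // | [/eqP-> /eqP->]].
  by rewrite expn0 muln1.
rewrite (bigD1 (Ordinal m_gt0)) //= !gE ?inE ?eqxx ?orbT // !andbT !expr1.
by rewrite big1 ?addr0 // => j j0; rewrite !gE ?inE ?eqxx ?orbT // -!val_eqE /= in j0 *;
   rewrite (negbTE j0) !andbF !mulr0 !addr0.
Qed.

Let tcC a b c x : x != 0 ->
  ~~ has (fun z => fconnect Frob z x) [:: g ^- 2; g ^- (p + 1); g ^- (p ^ 2 + 1)] ->
  root (codeword_poly (trace_codeword g a b c)) x.
Proof.
move=> x0; rewrite /= !negb_or => /and4P[n1 n2 n3 _].
have n e j : ~~ fconnect Frob (g ^- e) x -> (g ^+ (e * p ^ j) * x == 1) = false.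
  by move=> nc; apply/negbTE; apply: contra nc => /eqP/conjP; apply.
rewrite /root horner_trace_codeword // big1 ?oppr0 // => j _.
by rewrite !n // !mulr0 !addr0.
Qed.

Lemma cyclic_code_trace_gen :
  cyclic_code [:: g ^- 2; g ^- (p + 1); g ^- (p ^ 2 + 1)] =
  [set trace_codeword g t.1.1 t.1.2 t.2 | t : F * F * F].
Proof.
apply/setP => v; rewrite inE; apply/forallP/imsetP => [vC | [[[a b] c] _ ->] x].
  pose V e := - (codeword_poly v).[g ^- e].
  exists (V 2, V (p + 1), V (p ^ 2 + 1))%N => //=; set w := trace_codeword _ _ _ _.
  have eqvw e : e \in E -> (codeword_poly v).[g ^- e] = (codeword_poly w).[g ^- e].
    move=> eE; rewrite horner_nonzero //.
    have p1 := prime_gt1 (pcharf_prime pcharF).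
    have p2 : (p + 1 != 2)%N by rewrite addn1 eqSS gtn_eqF.
    have pp : (p ^ 2 + 1 != 2)%N by rewrite addn1 eqSS gtn_eqF // -{1}(exp1n 2) ltn_exp2r.
    have pq : (p ^ 2 + 1 != p + 1)%N by rewrite !addn1 eqSS -{2}(expn1 p) eqn_exp2l.
    move: eE; rewrite /V !inE => /or3P[] /eqP->; rewrite eqxx.
    - by rewrite ![2%N == _]eq_sym (negbTE p2) (negbTE pp) !mulr0 !addr0 mulr1 opprK.
    - rewrite [(p + 1 == p ^ 2 + 1)%N]eq_sym (negbTE p2) (negbTE pq).
      by rewrite !mulr0 addr0 add0r mulr1 opprK.
    - by rewrite (negbTE pp) (negbTE pq) !mulr0 !add0r mulr1 opprK.
  have vwE : codeword_poly (v - w) = codeword_poly v - codeword_poly w.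
    by rewrite /codeword_poly linearB rmorphB.
  apply/eqP; rewrite -subr_eq0; apply/eqP/codeword_poly0 => x x0.
  have [/hasP[z]|nx] := boolP (has (fun z => fconnect Frob z x)
     [:: g ^- 2; g ^- (p + 1); g ^- (p ^ 2 + 1)]).
    move=> zE /iter_findex<-; elim: findex => [|j IHj] /=.
      rewrite /root vwE hornerD hornerN subr_eq0; apply/eqP.
      by move: zE; rewrite !inE => /or3P[] /eqP->; apply: eqvw; rewrite !inE eqxx ?orbT.
    by rewrite /root /Frob codeword_polyXp (eqP IHj) expr0n; case: p (pcharf_prime pcharF).
  have /implyP := vC x; rewrite x0 nx => /(_ isT) vx.
  rewrite /root vwE hornerD hornerN (eqP vx) sub0r oppr_eq0.
  exact: tcC.
by apply/implyP => /andP[x0 nx]; apply: tcC.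
Qed.

End Delsarte.

End FiniteField.

(* The code with nonzeros g^-2, g^-(p+1), g^-(p^2+1) is the code of the words
   (Tr(a g^(2i) + b g^((p+1)i) + c g^((p^2+1)i)))_i. *)
Lemma cyclic_code_trace (F : finFieldType) (pcharF : 3%N \in [pchar F])
    (m : nat) (cardF : #|F| = (3 ^ m)%N) (m_gt5 : (5 < m)%N)
    (g : F) (g_prim : (#|F|.-1).-primitive_root g) :
  cyclic_code pcharF [:: g ^- 2; g ^- (3 + 1); g ^- (3 ^ 2 + 1)] =
  [set trace_codeword pcharF g t.1.1 t.1.2 t.2 | t : F * F * F].
Proof.
have m_gt0 : (0 < m)%N by apply: ltn_trans m_gt5.
apply: (@cyclic_code_trace_gen _ _ pcharF _ cardF m_gt0 _ g_prim) => e e' j.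
by rewrite cardF; apply: cyclotomic_cosets3.
Qed.

Section Weights.
Variables (K : nzRingType) (l : nat).

Definition hamming_weight (v : 'rV[K]_l) : nat := #|[set i | v 0 i != 0]|.

End Weights.

Section WeightDistribution.
Variables (K : finNzRingType) (l : nat) (C : {set 'rV[K]_l}).

Definition weight_count (w : nat) : nat := #|[set v in C | hamming_weight v == w]|.

Definition nonzero_weights : seq nat :=
  undup [seq hamming_weight v | v <- enum C & hamming_weight v != 0%N].

End WeightDistribution.

(* Main.v *)
(** For a triple t = (a, b, c) put f(x) = a x^2 + b x^4 + c x^10,
    psi(x) = zeta^(Tr x) and S(t) = sum_x psi(f(x)), so that S(-t) is the
    conjugate of S(t) and S(t) + S(-t) = 2q - 3 wt(t).

    The substitution (x, y) = (u + v, u - v) turns f(x) + f(y) into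
    -(f(u) + f(v)), hence S(t)^2 = S(-t)^2, and S(t) is real or purely imaginary.
    Also S(t) S(-t) = q |Rad t|, where Rad t is the zero set of a polynomial of
    degree at most 81, hence of size 3^k with k <= 4 when t <> 0.  As S(t) + S(-t)
    is an integer and S(t) - S(-t) an integer multiple of zeta - zeta^2, the
    parity of m + k decides between the two cases; this gives the weights and
    their frequencies.

    All seven weights occur: for d = 1 / (y^9 - y) and Q = 3, 9, the form
    Tr(d (x^Q - x)^2) is one of the forms Tr(f(x)), and its exponential sum is Q
    times the Gauss sum of d.  Both signs of the Gauss sum occur among
    such d, since otherwise sum_y G(y^9 - y) would be too large.  Finally
    Tr(d (x^3 - x)^2) with Tr(1/d) <> 0 has a purely imaginary sum. *)

Require Import Defs.
From mathcomp Require Import all_boot all_order all_algebra all_fingroup.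
From mathcomp Require Import all_solvable all_field.
From mathcomp Require Import complex reals exp trigo.
From mathcomp Require Import ring lra zify.

Import Order.TTheory GRing.Theory Num.Theory.
Local Open Scope ring_scope.

Set Implicit Arguments.
Unset Strict Implicit.
Unset Printing Implicit Defensive.

(** * Frobenius and the trace in characteristic 3 *)

Section ExponentialSums.
Variables (F : finFieldType) (pcharF : 3%N \in [pchar F]).
Variables (m : nat) (cardF : #|F| = (3 ^ m)%N).

Local Notation tr := (trace pcharF).
Local Notation q := (#|F|).

Let m_gt0 : (0 < m)%N.
Proof. by case: m cardF (finNzRing_gt1 F) => // ->. Qed.

Let three0 : 3%:R = 0 :> F.
Proof. exact: pcharf0. Qed.

Let twoE : 2%:R = -1 :> F.
Proof. by apply/eqP; rewrite -addr_eq0 natr1 three0. Qed.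

Let nat3 i : [pchar F].-nat (3 ^ i)%N.
Proof. by rewrite pnatX pnatE // pcharF. Qed.

Lemma expr3nD i (x y : F) : (x + y) ^+ (3 ^ i) = x ^+ (3 ^ i) + y ^+ (3 ^ i).
Proof. exact: exprDn_pchar. Qed.

Lemma expr3nN i (x : F) : (- x) ^+ (3 ^ i) = - x ^+ (3 ^ i).
Proof. by rewrite exprNn -signr_odd oddX /= orbT mulN1r. Qed.

Lemma expr3nB i (x y : F) : (x - y) ^+ (3 ^ i) = x ^+ (3 ^ i) - y ^+ (3 ^ i).
Proof. by rewrite expr3nD expr3nN. Qed.

Lemma expr3n_inj i : injective (fun x : F => x ^+ (3 ^ i)).
Proof.
move=> x y /= /eqP; rewrite -subr_eq0 -expr3nB expf_eq0 expn_gt0 /= subr_eq0.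
by move/eqP.
Qed.

Lemma expr3n_card (x : F) : x ^+ (3 ^ m) = x.
Proof. by rewrite -cardF expf_card. Qed.

Lemma traceD x y : tr (x + y) = tr x + tr y.
Proof. by rewrite /trace raddfD linearD. Qed.

Lemma trace0 : tr 0 = 0.
Proof. by rewrite /trace raddf0 linear0. Qed.

Lemma traceB x y : tr (x - y) = tr x - tr y.
Proof. by rewrite traceD traceN. Qed.

(** This carries identities from [F], where the trace is a power sum, back to ['F_3]. *)
Lemma Fp3_natr_inj (u v : 'F_3) : (u : nat)%:R = (v : nat)%:R :> F -> u = v.
Proof.
wlog uv : u v / (u <= v)%N.
  by move=> H; case: (leqP u v) => [|/ltnW] le e; [|symmetry]; apply: H.
move/eqP; rewrite eq_sym -subr_eq0 -natrB // -(dvdn_pcharf pcharF).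
move=> d; apply/val_inj => /=; move: u v uv d => [u ?] [v vP] /= uv d.
apply/eqP; rewrite eqn_leq uv -subn_eq0 eqn0Ngt.
apply: contraL d => vu0; rewrite gtnNdvd //.
exact: leq_ltn_trans (leq_subr _ _) vP.
Qed.

(** Cubing permutes the conjugates in the power sum cyclically, as [x ^+ (3 ^ m) = x]. *)
Lemma trace_frob i x : tr (x ^+ (3 ^ i)) = tr x.
Proof.
suff H y : tr (y ^+ 3) = tr y.
  by elim: i => [|i IH]; rewrite ?expr1 // expnSr exprM H.
apply: Fp3_natr_inj; rewrite !(traceE pcharF cardF).
case: m m_gt0 (expr3n_card y) => // n _ yE.
rewrite big_ord_recr big_ord_recl /= -exprM -expnS yE addrC expr1; congr (_ + _).
by apply: eq_bigr => j _; rewrite -exprM -expnS.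
Qed.

(** The trace is given by a nonzero polynomial of degree less than [q], which cannot vanish on all
    of [F]. *)
Lemma trace_surj x : x != 0 -> exists y, tr (x * y) != 0.
Proof.
move=> x0; suff [y y0] : exists y, tr y != 0.
  by exists (x^-1 * y); rewrite mulVKf.
apply/existsP; rewrite -negb_forall; apply/negP => /forallP trz.
pose P : {poly F} := \sum_(i < m) 'X^(3 ^ i).
have Pn0 : P != 0.
  have : P`_1 != 0.
    rewrite /P coef_sum; case: m m_gt0 => // n _.
    rewrite big_ord_recl coefXn big1 ?addr0 ?oner_neq0 // => j _.
    by rewrite coefXn /= /bump add1n expnS; case: (3 ^ j)%N => [|[|k]].
  by apply: contraNneq => ->; rewrite coef0.
have : all (root P) (enum F).
  apply/allP => x' _; rewrite /root /P horner_sum.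
  have := traceE pcharF cardF x'; rewrite (eqP (trz x')) => /esym e.
  by rewrite (eq_bigr (fun i : 'I_m => x' ^+ (3 ^ i))) ?e // => i _; rewrite hornerXn.
move/(max_poly_roots Pn0)/(_ (enum_uniq _)); rewrite -cardE cardF ltnNge.
apply/negP/negPn.
apply: leq_trans (size_sum _ _ _) _; apply/bigmax_leqP => i _.
by rewrite size_polyXn ltn_exp2l.
Qed.

(** * The additive character attached to a primitive cube root of unity *)

Variables (K : numFieldType) (zeta : K) (zetaP : zeta ^+ 2 + zeta + 1 = 0).

Lemma zeta_cube : zeta ^+ 3 = 1.
Proof.
rewrite -[RHS]add0r -[in RHS](mulr0 (zeta - 1)) -zetaP; ring.
Qed.

Definition addchar (x : F) : K := zeta ^+ tr x.
Local Notation psi := addchar.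

Lemma addchar0 : psi 0 = 1.
Proof. by rewrite /psi trace0. Qed.

Lemma addcharD x y : psi (x + y) = psi x * psi y.
Proof.
rewrite /psi traceD -exprD /= !/Zp_trunc /=.
by rewrite -[in RHS](expr_mod _ zeta_cube).
Qed.

Lemma addchar_trace0 x : tr x = 0 -> psi x = 1.
Proof. by rewrite /psi => ->. Qed.

Lemma addchar_frob i x : psi (x ^+ (3 ^ i)) = psi x.
Proof. by rewrite /psi trace_frob. Qed.

Lemma zeta_neq1 : zeta != 1.
Proof.
apply: contra_eqN zetaP => /eqP->; rewrite expr1n.
by rewrite (_ : 1 + 1 + 1 = 3%:R) ?pnatr_eq0 //; ring.
Qed.

Lemma addchar_eq1 x : (psi x == 1) = (tr x == 0).
Proof.
apply/eqP/eqP=> [|/addchar_trace0 //]; rewrite /psi.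
have z2 : zeta ^+ 2 != 1.
  apply: contraNneq zeta_neq1 => e; have := zeta_cube.
  by rewrite exprS e mulr1 => ->.
case: (tr x) => -[|[|[|//]]] //= p e; first exact: val_inj.
  by move: zeta_neq1; rewrite -e eqxx.
by move: z2; rewrite e eqxx.
Qed.

(** For [b != 0], translating by some [y] with [tr (b * y) != 0] multiplies the sum by
    [psi (b * y)], which is not 1. *)
Lemma sum_addchar b : \sum_x psi (b * x) = if b == 0 then q%:R else 0.
Proof.
have [->|b0] := eqVneq b 0.
  under eq_bigr => x _ do rewrite mul0r addchar0.
  by rewrite sumr_const.
have [y yP] := trace_surj b0; rewrite -addchar_eq1 in yP.
apply: (mulfI (x := psi (b * y) - 1)); first by rewrite subr_eq0.
rewrite mulr0 mulrBl mul1r mulr_sumr; apply/eqP; rewrite subr_eq0; apply/eqP.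
rewrite [RHS](reindex_inj (addrI y)) /=; apply: eq_bigr => x _.
by rewrite mulrDr addcharD.
Qed.

Lemma addchar_sumN x : psi x + psi (- x) = 3%:R * (tr x == 0)%:R - 1.
Proof.
have zE : zeta ^+ 2 + zeta = -1 by apply/eqP; rewrite -addr_eq0 zetaP.
rewrite /psi traceN; case: (tr x) => -[|[|[|//]]] //= i.
- by ring.
- by rewrite -[X in _ + X]/(zeta ^+ 2); transitivity (-1 : K); [rewrite -zE|]; ring.
- by rewrite -[X in _ + X]/(zeta ^+ 1); transitivity (-1 : K); [rewrite -zE|]; ring.
Qed.

Lemma addchar_subN x : exists n : int, psi x - psi (- x) = n%:~R * (zeta - zeta ^+ 2).
Proof.
rewrite /psi traceN; case: (tr x) => -[|[|[|//]]] //= i.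
- by exists 0; rewrite /=; ring.
- by exists 1; rewrite -[X in _ - X]/(zeta ^+ 2); ring.
- by exists (-1); rewrite -[X in _ - X]/(zeta ^+ 1); ring.
Qed.

(** * The quadratic forms, their polar forms and radicals *)

Definition trinomial (t : F * F * F) (x : F) : F :=
  t.1.1 * x ^+ 2 + t.1.2 * x ^+ (3 + 1) + t.2 * x ^+ (3 ^ 2 + 1).

Definition esum (t : F * F * F) : K := \sum_x psi (trinomial t x).

(** The polar form of [tr (trinomial t _)] is [tr (polar t z * y ^+ 9)]: each cross term is raised
    to the power 1, 3 or 9, which keeps its trace, until [y] appears as [y ^+ 9]. No roots of the
    coefficients are needed. The coefficient 2 of the term [a * y * z] has become -1. *)
Definition polar (t : F * F * F) (z : F) : F :=
  t.2 * z + t.1.2 ^+ 3 * z ^+ 3 - t.1.1 ^+ 9 * z ^+ 9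
  + t.1.2 ^+ 9 * z ^+ 27 + t.2 ^+ 9 * z ^+ 81.

Definition radical (t : F * F * F) : {set F} := [set z | polar t z == 0].

Lemma trinomial_opp t x : trinomial (- t) x = - trinomial t x.
Proof. rewrite /trinomial /=; ring. Qed.

Lemma trinomialB t u x : trinomial (t - u) x = trinomial t x - trinomial u x.
Proof. rewrite /trinomial /=; ring. Qed.

Lemma trinomialN t x : trinomial t (- x) = trinomial t x.
Proof. rewrite /trinomial; ring. Qed.

Lemma trinomial0 t : trinomial t 0 = 0.
Proof. rewrite /trinomial; ring. Qed.

(** Each exponent has the form [3 ^ i + 1], so this is the parallelogram law with its factor 2 read
    as -1. *)
Lemma trinomial_parallelogram t u v :
  trinomial t (u + v) + trinomial t (u - v) = - (trinomial t u + trinomial t v).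
Proof.
have H i : (u + v) ^+ (3 ^ i + 1) + (u - v) ^+ (3 ^ i + 1) =
           - (u ^+ (3 ^ i + 1) + v ^+ (3 ^ i + 1)).
  rewrite !exprD !expr1 expr3nD expr3nB -[RHS]mulN1r -twoE; ring.
rewrite /trinomial.
have := (H 0%N, H 1%N, H 2%N); rewrite expn0 expn1 !add1n => -[[H0 H1] H2].
transitivity (t.1.1 * ((u + v) ^+ 2 + (u - v) ^+ 2) +
  t.1.2 * ((u + v) ^+ (3 + 1) + (u - v) ^+ (3 + 1)) +
  t.2 * ((u + v) ^+ (3 ^ 2 + 1) + (u - v) ^+ (3 ^ 2 + 1))).
  by rewrite !mulrDr; move: (_ ^+ (3 ^ 2 + 1)) => ? *; ring.
rewrite H0 H1 H2; move: (u ^+ (3 ^ 2 + 1)) (v ^+ (3 ^ 2 + 1)) => ? ?; ring.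
Qed.

Lemma esum_sqr_opp t : esum t ^+ 2 = esum (- t) ^+ 2.
Proof.
have sq u : esum u ^+ 2 = \sum_(x : F * F) psi (trinomial u x.1 + trinomial u x.2).
  rewrite expr2 mulr_suml -(pair_bigA _ (fun x y => psi (trinomial u x + trinomial u y))).
  apply: eq_bigr => x _; rewrite mulr_sumr; apply: eq_bigr => y _.
  by rewrite addcharD.
(* The sum of the two components is [2 x = - x], so it determines [x]. *)
have h_inj : injective (fun x : F * F => (x.1 + x.2, x.1 - x.2)).
  move=> [x y] [x' y'] /= [e1 e2].
  have ex : x = x'.
    apply: oppr_inj; rewrite -[LHS]mulN1r -[RHS]mulN1r -twoE.
    transitivity ((x + y) + (x - y)); first by ring.
    by rewrite e1 e2; ring.
  by move: e1; rewrite ex => /addrI ->.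
rewrite !sq (reindex_inj h_inj) /=; apply: eq_bigr => -[x y] _ /=.
by rewrite trinomial_parallelogram !trinomial_opp opprD.
Qed.

Lemma trace_trinomialD t y z :
  tr (trinomial t (y + z)) =
    tr (trinomial t y) + tr (trinomial t z) + tr (polar t z * y ^+ 9).
Proof.
have -> : tr (polar t z * y ^+ 9) = tr (- (t.1.1 * y * z)) + tr (t.1.2 * y ^+ 3 * z) +
   tr (t.1.2 * y * z ^+ 3) + tr (t.2 * y ^+ 9 * z) + tr (t.2 * y * z ^+ 9).
  rewrite -(trace_frob 2 (- (t.1.1 * y * z))) -(trace_frob 1 (t.1.2 * y ^+ 3 * z)).
  rewrite -(trace_frob 2 (t.1.2 * y * z ^+ 3)) -(trace_frob 2 (t.2 * y * z ^+ 9)).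
  rewrite -!traceD expr3nN -[(3 ^ 1)%N]/3%N -[(3 ^ 2)%N]/9%N.
  have E i j k (a u v : F) : (a * u ^+ j * v ^+ k) ^+ i = a ^+ i * u ^+ (j * i) * v ^+ (k * i).
    by rewrite 2!exprMn -!exprM.
  have := (E 3 3 1 t.1.2 y z, E 9 1 3 t.1.2 y z, E 9 1 9 t.2 y z, E 9 1 1 t.1.1 y z)%N.
  rewrite !expr1 => -[[[-> ->] ->] ->]; rewrite /polar; congr tr.
  rewrite !mul1n -[(3 * 3)%N]/9%N -[(3 * 9)%N]/27%N -[(9 * 9)%N]/81%N.
  by move: (z ^+ 81) (z ^+ 27) (z ^+ 9) (y ^+ 9) (t.1.2 ^+ 9) (t.2 ^+ 9) (t.1.1 ^+ 9) => *; ring.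
rewrite -!traceD; congr tr; rewrite /trinomial.
rewrite -[2%N]/(3 ^ 0 + 1)%N -[(3 + 1)%N]/(3 ^ 1 + 1)%N !exprD !expr1 !expr3nD.
rewrite -[(3 ^ 0)%N]/1%N -[(3 ^ 1)%N]/3%N -[(3 ^ 2)%N]/9%N ?expr1.
have -> : - (t.1.1 * y * z) = 2%:R * (t.1.1 * y * z) by rewrite twoE mulN1r.
by move: (y ^+ 9) (z ^+ 9) => *; ring.
Qed.

(** Polarization at [z + z] gives [Tr f(2z) = 2 Tr f(z)]; but [2z = -z] and [f] is even, so
    [Tr f(z) = 2 Tr f(z)]. *)
Lemma trace_trinomial_radical t z : z \in radical t -> tr (trinomial t z) = 0.
Proof.
rewrite inE => /eqP Lz; have := trace_trinomialD t z z.
have -> : z + z = - z by rewrite -mulr2n -mulr_natl twoE mulN1r.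
rewrite trinomialN Lz mul0r trace0 addr0 => /eqP.
by rewrite -subr_eq0 opprD addrA subrr sub0r oppr_eq0 => /eqP.
Qed.

(** Writing the variable of [esum t] as [y + z], with [y] that of [esum (- t)], leaves
    [psi (trinomial t z)] times a character sum in [y ^+ 9]. It is [q] for [z] in the radical, where
    the first factor is 1, and 0 elsewhere. *)
Lemma esum_mul_opp t : esum t * esum (- t) = (q * #|radical t|)%:R.
Proof.
rewrite mulrC mulr_suml.
transitivity (\sum_y \sum_z psi (trinomial t z) * psi (polar t z * y ^+ 9)).
  apply: eq_bigr => y _; rewrite mulr_sumr (reindex_inj (addrI y)) /=.
  apply: eq_bigr => z _; rewrite -!addcharD /psi; congr (_ ^+ nat_of_ord _).
  rewrite trinomial_opp (traceD (- _)) trace_trinomialD traceN.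
  by rewrite (traceD (trinomial t z)) !addrA addNr add0r.
rewrite exchange_big natrM -sum1_card natr_sum mulr_sumr [RHS]big_mkcond /=.
apply: eq_bigr => z _; rewrite -mulr_sumr.
have -> : \sum_y psi (polar t z * y ^+ 9) = \sum_y psi (polar t z * y).
  by rewrite [RHS](reindex_inj (@expr3n_inj 2)).
rewrite sum_addchar; have := erefl (z \in radical t); rewrite {1}inE.
case: eqP => _ /esym zr; rewrite zr ?mulr0 // mulr1.
by rewrite (addchar_trace0 (trace_trinomial_radical zr)) mul1r.
Qed.

Lemma polarD t y z : polar t (y + z) = polar t y + polar t z.
Proof.
rewrite /polar (expr3nD 1 y z : (y + z) ^+ 3 = _) (expr3nD 2 y z : (y + z) ^+ 9 = _).
rewrite (expr3nD 3 y z : (y + z) ^+ 27 = _) (expr3nD 4 y z : (y + z) ^+ 81 = _).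
rewrite -[(3 ^ 1)%N]/3%N -[(3 ^ 2)%N]/9%N -[(3 ^ 3)%N]/27%N -[(3 ^ 4)%N]/81%N; ring.
Qed.

(** The radical is an additive subgroup, so its order is a power of 3; it is also the zero set of a
    nonzero polynomial of degree at most 81. *)
Lemma card_radical t : t != 0 -> exists2 k, (k <= 4)%N & #|radical t| = (3 ^ k)%N.
Proof.
move=> t0; have gr : group_set (radical t).
  apply/group_setP; split=> [|y z]; rewrite !inE.
    by apply/eqP/(addrI (polar t 0)); rewrite -polarD !addr0.
  by move=> /eqP y0 /eqP z0; rewrite [polar _ _]polarD y0 z0 addr0.
have /(dvdn_pfactor _ _ (isT : prime 3)) [k _ radE] : (#|radical t| %| 3 ^ m)%N.
  rewrite -cardF -cardsT; apply: (@cardSg _ [set: F]%G (Group gr)).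
  exact: subsetT.
exists k => //; pose P : {poly F} :=
  t.2 *: 'X + t.1.2 ^+ 3 *: 'X^3 - t.1.1 ^+ 9 *: 'X^9
  + t.1.2 ^+ 9 *: 'X^27 + t.2 ^+ 9 *: 'X^81.
have PE z : P.[z] = polar t z by rewrite /P !(hornerD, hornerN, hornerZ, hornerXn, hornerX).
have Pn0 : P != 0.
  apply: contraNneq t0 => P0.
  (* These three coefficients are [c], [b ^+ 3] and [- a ^+ 9] for [t = (a, b, c)]. *)
  have := (congr1 (coefp 1) P0, congr1 (coefp 3) P0, congr1 (coefp 9) P0).
  rewrite /coefp !(coefD, coefN, coefZ, coefXn, coefX, coef0) /=.
  rewrite !(mulr0, mulr1, addr0, add0r, oppr0) => -[[c0 /eqP b0] /eqP a0].
  move: b0 a0; rewrite oppr_eq0 !expf_eq0 /= => /eqP b0 /eqP a0.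
  by case: t {radE gr P PE P0} a0 b0 c0 => [[a b] c] /= -> -> ->.
have : all (root P) (enum (radical t)).
  by apply/allP => z; rewrite mem_enum inE /root PE.
move/(max_poly_roots Pn0)/(_ (enum_uniq _)); rewrite -cardE radE => kP.
have : (3 ^ k < 3 ^ 5)%N.
  apply: leq_trans kP _; apply: (@leq_trans 82) => //.
  apply/leq_sizeP => j jP; rewrite /P !(coefD, coefN, coefZ, coefXn, coefX).
  by rewrite !gtn_eqF ?(leq_trans _ jP) // !(mulr0, addr0, oppr0).
by rewrite ltn_exp2l.
Qed.

(** * Weights and the possible values of the sums *)

Definition trinomial_weight (t : F * F * F) : nat := #|[set x | tr (trinomial t x) != 0]|.

(** Each [x] contributes 2 if the trace vanishes and -1 otherwise. *)
Lemma esum_add_opp t : esum t + esum (- t) = 2%:R * q%:R - 3%:R * (trinomial_weight t)%:R.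
Proof.
rewrite -big_split /=.
rewrite (eq_bigr (fun x => 2%:R - 3%:R * (tr (trinomial t x) != 0)%:R)) => [|x _]; last first.
  by rewrite trinomial_opp addchar_sumN; case: eqP => _ /=; ring.
rewrite sumrB sumr_const -mulr_sumr -[_ *+ #|_|]mulr_natr; congr (_ - 3%:R * _).
by rewrite -natr_sum /trinomial_weight cardsE -sum1_card [in RHS]big_mkcond.
Qed.

Lemma esum_sub_opp t : exists n : int, esum t - esum (- t) = n%:~R * (zeta - zeta ^+ 2).
Proof.
rewrite -sumrB /=; elim/big_ind: _ => [|x y [n ->] [n' ->]|x _].
- by exists 0; rewrite mul0r.
- by exists (n + n'); rewrite rmorphD mulrDl.
- by rewrite trinomial_opp; apply: addchar_subN.
Qed.

Lemma sqr_zetaB : (zeta - zeta ^+ 2) ^+ 2 = - 3%:R.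
Proof.
have -> : zeta ^+ 2 = - zeta - 1.
  by rewrite -[LHS]addr0 -oppr0 -zetaP; ring.
have -> : (zeta - (- zeta - 1)) ^+ 2 = 4%:R * (zeta ^+ 2 + zeta + 1) - 3%:R by ring.
by rewrite zetaP mulr0 sub0r.
Qed.

(** Compare 3-adic valuations; 4 is prime to 3. *)
Lemma even_exp3 (n : int) k : n ^+ 2 = 4%:R * 3%:R ^+ k -> ~~ odd k.
Proof.
move=> /(congr1 absz); rewrite abszX abszM abszX /= => e.
have := congr1 (logn 3) e; rewrite lognX lognM ?expn_gt0 // pfactorK // (_ : logn 3 4 = 0%N) //.
by rewrite add0n => <-; rewrite oddM.
Qed.

Lemma odd_exp3 (n : int) k : 3%:R * n ^+ 2 = 4%:R * 3%:R ^+ k -> odd k.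
Proof.
move=> /(congr1 absz); rewrite !abszM !abszX /= => e.
have n0 : (0 < `|n|)%N.
  by rewrite lt0n; apply: contra_eqN e => /eqP ->; rewrite muln0 eq_sym muln_eq0 expn_eq0.
have {}e : (3 ^ 1 * `|n| ^ 2 = 4 * 3 ^ k)%N by exact: e.
have := congr1 (logn 3) e.
rewrite (@lognM 3 (3 ^ 1)) ?(@lognM 3 4) ?expn_gt0 ?n0 // !pfactorK // lognX.
by rewrite (_ : logn 3 4 = 0%N) // add0n => <-; rewrite oddD oddM.
Qed.

(** From [esum_sqr_opp], [esum (- t)] is [esum t] or its opposite. In the first case [2 * esum t] is
    an integer with square [4 * 3 ^ (m + k)], so [m + k] is even. In the second it is
    [n * (zeta - zeta ^+ 2)], with square [- 3 * n ^ 2], so [m + k] is odd. *)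
Lemma esum_cases t : t != 0 -> exists2 k, (k <= 4)%N &
  [/\ esum t * esum (- t) = (3 ^ (m + k))%:R &
      if odd (m + k) then esum (- t) = - esum t else
        esum (- t) = esum t /\ (esum t = (3 ^ (m + k)./2)%:R \/ esum t = - (3 ^ (m + k)./2)%:R)].
Proof.
move=> /card_radical[k k4 rk]; exists k => //.
have SS : esum t * esum (- t) = (3 ^ (m + k))%:R.
  by rewrite esum_mul_opp rk cardF expnD.
split=> //; have /eqP := esum_sqr_opp t; rewrite eqf_sqr => /orP[] /eqP E.
- have Z : 2%:R * esum t = 2%:R * q%:R - 3%:R * (trinomial_weight t)%:R.
    by rewrite -esum_add_opp -E mulr_natl mulr2n.
  have ev : ~~ odd (m + k).
    apply: (@even_exp3 (2%:R * q%:R - 3%:R * (trinomial_weight t)%:R)).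
    apply: (@intr_inj K); rewrite !(rmorphXn, rmorphM, rmorphB) /= !rmorph_nat.
    by rewrite -Z exprMn expr2 -natrM expr2 {2}E SS natrX.
  rewrite (negbTE ev); split=> //; apply/pred2P; rewrite -eqf_sqr expr2 {2}E SS.
  by rewrite -natrX -expnM muln2 even_halfK.
- have E' : esum (- t) = - esum t by rewrite E opprK.
  have [n] := esum_sub_opp t; rewrite E' opprK -mulr2n -[esum t *+ 2]mulr_natl => Z.
  suff -> : odd (m + k) by [].
  apply: (@odd_exp3 n); apply: (@intr_inj K).
  rewrite !(rmorphXn, rmorphM) /= !rmorph_nat -natrX -SS E' mulrN -expr2.
  have := congr1 (fun z => z ^+ 2) Z; rewrite !exprMn sqr_zetaB => e.
  transitivity (- (2%:R ^+ 2 * esum t ^+ 2)); last by ring.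
  by rewrite e; ring.
Qed.

(** * Gauss sums and forms pulled back along [x ^+ (3 ^ r) - x] *)

Definition gauss (d : F) : K := \sum_x psi (d * x ^+ 2).

(** For [r] dividing [m] this is the subfield with [3 ^ r] elements. *)
Definition Fix (r : nat) : {set F} := [set c | c ^+ (3 ^ r) == c].

Lemma esum_diag d : esum (d, 0, 0) = gauss d.
Proof. by apply: eq_bigr => x _; rewrite /trinomial /= !mul0r !addr0. Qed.

Lemma gaussM_sqr d c : c != 0 -> gauss (d * c ^+ 2) = gauss d.
Proof.
move=> c0; rewrite [RHS](reindex_inj (mulfI c0)) /=; apply: eq_bigr => x _.
by rewrite exprMn -mulrA.
Qed.

Lemma gaussV d : d != 0 -> gauss d^-1 = gauss d.
Proof.
move=> d0; have {1}-> : d^-1 = d * d^-1 ^+ 2 by field.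
by rewrite gaussM_sqr ?invr_eq0.
Qed.

Lemma gauss_frob i d : gauss (d ^+ (3 ^ i)) = gauss d.
Proof.
rewrite [LHS](reindex_inj (@expr3n_inj i)); apply: eq_bigr => x _ /=.
by rewrite -[RHS](addchar_frob i) exprMn -!exprM (mulnC (3 ^ i)%N 2%N).
Qed.

(* Fourier inversion detects [u = x ^+ (3 ^ r) - x]; then complete the square. *)
Lemma sum_addchar_pullback r d : d != 0 ->
  \sum_x psi (d * (x ^+ (3 ^ r) - x) ^+ 2) =
    gauss d * \sum_(c in Fix r) psi (- (c ^+ 2 / d)).
Proof.
move=> d0; have q0 : q%:R != 0 :> K by rewrite cardF pnatr_eq0 expn_eq0.
apply: (mulfI q0).
transitivity (\sum_x \sum_u \sum_b psi (d * u ^+ 2) * psi ((x ^+ (3 ^ r) - x - u) * b)).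
  rewrite mulr_sumr; apply: eq_bigr => x _.
  under [RHS]eq_bigr => u _ do rewrite -mulr_sumr sum_addchar.
  rewrite (bigD1 (x ^+ (3 ^ r) - x)) //= subrr eqxx mulrC big1 ?addr0 // => u.
  by rewrite eq_sym -subr_eq0 => /negbTE ->; rewrite mulr0.
(* Moving Frobenius from [x] to [b] makes the sum over [x] the indicator of [b] in [Fix r]. *)
transitivity (\sum_b \sum_u psi (d * u ^+ 2 - u * b) * \sum_x psi ((b - b ^+ (3 ^ r)) * x)).
  rewrite exchange_big; under eq_bigr => u _ do rewrite exchange_big.
  rewrite exchange_big; apply: eq_bigr => b _; apply: eq_bigr => u _.
  rewrite [in RHS](reindex_inj (@expr3n_inj r)) mulr_sumr /=; apply: eq_bigr => x _.
  have -> : (b - b ^+ (3 ^ r)) * x ^+ (3 ^ r) = x ^+ (3 ^ r) * b + (- (x * b)) ^+ (3 ^ r).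
    by rewrite expr3nN exprMn; ring.
  by rewrite !mulrBl !addcharD addchar_frob; ring.
rewrite mulrCA [in RHS]big_mkcond !mulr_sumr; apply: eq_bigr => b _ /=.
rewrite -mulr_suml sum_addchar subr_eq0 inE eq_sym; case: eqP => _; last by rewrite !mulr0.
rewrite mulrC mulrCA; congr (_ * _).
(* Since 2 = -1, the shift by [b / d] completes the square; the error is a multiple of 3. *)
rewrite mulr_suml (reindex_inj (subIr (b / d))) /=.
apply: eq_bigr => u _; rewrite -addcharD; congr psi.
have -> : d * (u - b / d) ^+ 2 - (u - b / d) * b =
  d * u ^+ 2 - b ^+ 2 / d + 3%:R * (b ^+ 2 / d - u * b) by field.
by rewrite three0 mul0r addr0.
Qed.

(** Here [c ^+ 9 = c], so with [w = c ^+ 2 * y] the argument of [psi] is [w - w ^+ 9], of trace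
    0. *)
Lemma sum_Fix_trivial r y : (r %| 2)%N ->
  \sum_(c in Fix r) psi (- (c ^+ 2 * (y ^+ 9 - y))) = #|Fix r|%:R.
Proof.
move=> r2; rewrite -sum1_card natr_sum; apply: eq_bigr => c; rewrite inE => /eqP cE.
have c9 : c ^+ 9 = c.
  case/dvdnP: r2 => k e; have : c ^+ (3 ^ (k * r)) = c.
    elim: k {e} => [|k IH]; first by rewrite expr1.
    by rewrite mulSn expnD exprM cE.
  by rewrite -e.
apply: addchar_trace0.
have -> : - (c ^+ 2 * (y ^+ 9 - y)) = c ^+ 2 * y - (c ^+ 2 * y) ^+ (3 ^ 2).
  by rewrite exprMn -exprM mulnC exprM -[(3 ^ 2)%N]/9%N c9; ring.
by rewrite traceB trace_frob subrr.
Qed.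

(** At most [3 ^ r] elements are roots of [X^(3^r) - X]; conversely 0 and the powers of a primitive
    root of unity of order [3 ^ r - 1], itself a power of [g], all are. *)
Lemma card_Fix (g : F) (g_prim : q.-1.-primitive_root g) r : (0 < r)%N -> (r %| m)%N -> #|Fix r| = (3 ^ r)%N.
Proof.
move=> r0 rm; have r1 : (1 < 3 ^ r)%N by rewrite -{1}(expn0 3) ltn_exp2l.
have dv : ((3 ^ r).-1 %| q.-1)%N.
  case/dvdnP: rm => k e; rewrite cardF e mulnC expnM.
  by rewrite (predn_exp (3 ^ r) k) dvdn_mulr.
have zP := dvdn_prim_root g_prim dv; set z := g ^+ _ in zP.
have z0 : z != 0.
  apply: contra_eqN (prim_expr_order zP) => /eqP ->.
  by rewrite expr0n gtn_eqF ?(prim_order_gt0 zP) // eq_sym oner_neq0.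
apply/eqP; rewrite eqn_leq; apply/andP; split.
  pose P : {poly F} := 'X^(3 ^ r) - 'X.
  have sP : size P = (3 ^ r).+1.
    by rewrite size_polyDl size_polyXn // size_polyN size_polyX ltnS.
  have Pn0 : P != 0 by rewrite -size_poly_eq0 sP.
  have : all (root P) (enum (Fix r)).
    apply/allP => c; rewrite mem_enum inE /root => /eqP cE.
    by rewrite hornerD hornerN hornerXn hornerX cE subrr.
  by move/(max_poly_roots Pn0)/(_ (enum_uniq _)); rewrite -cardE sP ltnS.
pose s := 0 :: [seq z ^+ i | i <- iota 0 (3 ^ r).-1].
have us : uniq s.
  rewrite /= map_inj_in_uniq ?iota_uniq ?andbT.
    by apply/mapP => -[i _ /esym/eqP]; rewrite expf_eq0 (negbTE z0) andbF.
  move=> i j; rewrite !mem_iota !add0n /= => im jm /eqP.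
  by rewrite (eq_prim_root_expr zP) !modn_small // => /eqP.
have <- : size s = (3 ^ r)%N by rewrite /= size_map size_iota prednK // ltnW.
rewrite -(card_uniqP us); apply/subset_leq_card/subsetP => c.
rewrite !inE => /orP[/eqP -> | /mapP[i _ ->]]; first by rewrite expr0n expn_eq0.
by rewrite -exprM -(prednK (ltnW r1)) mulnS exprD mulnC exprM (prim_expr_order zP) expr1n mulr1.
Qed.

Lemma size_uniq_roots_le (s : seq F) (P : {poly F}) n : (size P <= n.+1)%N -> P != 0 ->
  uniq s -> all (root P) s -> (size s <= n)%N.
Proof. by move=> sP Pn0 us /(max_poly_roots Pn0)/(_ us) h; rewrite -ltnS (leq_trans h). Qed.

(** * Values of the sums that occur when [m] is even *)

Section EvenDegree.
Hypotheses (m_even : ~~ odd m) (m_ge6 : (6 <= m)%N).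
Variables (g : F) (g_prim : q.-1.-primitive_root g).

(** The polar form of [(d, 0, 0)] is [- d ^+ 9 * z ^+ 9], so the radical is trivial and [k = 0] in
    [esum_cases]. *)
Lemma gauss_oppE d : d != 0 ->
  gauss (- d) = gauss d /\
  (gauss d = (3 ^ m./2)%:R \/ gauss d = - (3 ^ m./2)%:R).
Proof.
move=> d0; pose t : F * F * F := (d, 0, 0).
have t0 : t != 0 by apply: contraNneq d0 => -[->].
have [k _ [e]] := esum_cases t0.
have rad1 : #|radical t| = 1%N.
  apply/eqP/cards1P; exists 0; apply/setP => z; rewrite !inE /polar /=.
  rewrite !expr0n /= !mul0r add0r !addr0 add0r oppr_eq0 mulf_eq0 !expf_eq0 /=.
  by rewrite (negbTE d0).
have -> : k = 0%N.
  move: e; rewrite esum_mul_opp rad1 muln1 cardF => /eqP.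
  by rewrite eqr_nat eqn_exp2l // -{1}[m]addn0 eqn_add2l => /eqP.
have -> : - t = (- d, - 0, - 0) by []; rewrite !oppr0.
by rewrite addn0 (negbTE m_even) !esum_diag.
Qed.

Lemma card_large : [/\ (729 <= q)%N, (27 <= 3 ^ m./2)%N & q = (3 ^ m./2 * 3 ^ m./2)%N].
Proof.
have m3 : (3 <= m./2)%N := half_leq m_ge6.
split; last 1 first.
- by rewrite cardF -expnD addnn even_halfK.
- by rewrite cardF (@leq_pexp2l 3 6).
- by rewrite (@leq_pexp2l 3 3).
Qed.

(** Sum over [y] first: [x ^+ 2 * (y ^+ 9 - y)] has the same trace as [(x ^+ 2 - x ^+ 18) * y ^+ 9],
    so only [x] with [x ^+ 18 = x ^+ 2] contribute, each [q]. *)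
Lemma sum_gauss_pullback :
  \sum_y gauss (y ^+ 9 - y) = (q * #|[set x : F | x ^+ 18 == x ^+ 2]|)%:R.
Proof.
rewrite exchange_big natrM -sum1_card natr_sum mulr_sumr [RHS]big_mkcond /=.
apply: eq_bigr => x _.
transitivity (\sum_y psi ((x ^+ 2 - x ^+ 18) * y)).
  rewrite [RHS](reindex_inj (@expr3n_inj 2)); apply: eq_bigr => y _ /=.
  have -> : (x ^+ 2 - x ^+ 18) * y ^+ (3 ^ 2) = x ^+ 2 * y ^+ 9 + (- (x ^+ 2 * y)) ^+ (3 ^ 2).
    by rewrite expr3nN exprMn -exprM -[(2 * 3 ^ 2)%N]/18%N -[(3 ^ 2)%N]/9%N mulrBl.
  by rewrite addcharD addchar_frob -addcharD; congr psi; ring.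
by rewrite sum_addchar subr_eq0 inE eq_sym; case: ifP; rewrite ?mulr1.
Qed.

(* If gauss were constant off the kernel, both sides of sum_gauss_pullback would
   have incompatible sizes: about q^(3/2) against at most 18 q. *)
Lemma gauss_both_signs (s : bool) :
  exists y, y ^+ 9 - y != 0 /\ gauss (y ^+ 9 - y) = (-1) ^+ s * (3 ^ m./2)%:R.
Proof.
have [q_ge t_ge qE] := card_large.
set v := _ * _; pose Z := [set y : F | y ^+ 9 - y == 0].
have [/existsP[y /andP[y0 /eqP yv]]|none] :=
  boolP [exists y, (y ^+ 9 - y != 0) && (gauss (y ^+ 9 - y) == v)]; first by exists y.
have others y : y ^+ 9 - y != 0 -> gauss (y ^+ 9 - y) = - v.
  move=> y0; have [_ H] := gauss_oppE y0.
  have : gauss (y ^+ 9 - y) != v.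
    by apply: contra none => e; apply/existsP; exists y; rewrite y0.
  rewrite /v; case: s {v none} => /=; rewrite ?mulN1r ?mul1r ?opprK.
    by case: H => ->; rewrite ?eqxx.
  by case: H => ->; rewrite ?eqxx.
have g0 : gauss 0 = q%:R.
  rewrite /gauss (eq_bigr (fun=> 1)) ?sumr_const // => x _.
  by rewrite mul0r addchar0.
have := sum_gauss_pullback; set n := #|_|.
rewrite (bigID (mem Z)) /= (eq_bigr (fun=> q%:R)) => [|y]; last first.
  by rewrite inE => /eqP ->.
rewrite sumr_const [X in _ + X](eq_bigr (fun=> - v)) => [|y]; last first.
  by rewrite inE; apply: others.
rewrite sumr_const -[q%:R *+ _]mulr_natr -[- v *+ _]mulr_natr.
have -> : #|[pred y | y \notin Z]| = (q - #|Z|)%N.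
  by rewrite -(cardC (mem Z)) addKn; apply: eq_card => y; rewrite !inE.
have Zle : (#|Z| <= 9)%N.
  have sP : size ('X^9 - 'X : {poly F}) = 10%N.
    by rewrite size_polyDl size_polyXn // size_polyN size_polyX.
  rewrite cardE; apply: (size_uniq_roots_le (P := 'X^9 - 'X)); rewrite ?sP ?enum_uniq //.
    by rewrite -size_poly_eq0 sP.
  apply/allP => y; rewrite mem_enum inE /root => /eqP yE.
  by rewrite hornerD hornerN hornerXn hornerX yE.
have nle : (n <= 18)%N.
  have sP : size ('X^18 - 'X^2 : {poly F}) = 19%N.
    by rewrite size_polyDl size_polyXn // size_polyN size_polyXn.
  rewrite /n cardE; apply: (size_uniq_roots_le (P := 'X^18 - 'X^2)); rewrite ?sP ?enum_uniq //.
    by rewrite -size_poly_eq0 sP.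
  apply/allP => y; rewrite mem_enum inE /root => /eqP yE.
  by rewrite hornerD hornerN !hornerXn yE subrr.
have Zq : (#|Z| <= q)%N by rewrite -cardsT subset_leq_card ?subsetT.
(* As [T >= 27], [Q >= 729] and [k <= 9], the term [T * (Q - k)] exceeds both [Q * n'] and [Q * k],
   which refutes either equation below. *)
move: q_ge t_ge Zle nle Zq; rewrite /v; move: (3 ^ m./2)%N q #|Z| n => T Q k n' Q_ge T_ge k9 n18 kQ.
case: s {none others v qE} => /=; rewrite ?mulN1r ?mul1r ?opprK => e.
- have : (Q * k + T * (Q - k) = Q * n')%N.
    by apply/eqP; rewrite -(eqr_nat K) natrD !natrM e natrM.
  by nia.
- have : (Q * k = Q * n' + T * (Q - k))%N.
    apply/eqP; rewrite -(eqr_nat K) natrD -e !natrM; apply/eqP; ring.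
  by nia.
Qed.

(** By hypothesis the two forms differ by some [w - w ^+ (3 ^ r)], which [psi] sends to 1. Using
    [d ^+ (3 ^ r)] rather than [d] keeps roots of [d] out of [t]; Frobenius removes the power again
    because it fixes [c]. *)
Lemma esum_pullback r t d : d != 0 ->
  (forall x, trinomial t x - d ^+ (3 ^ r) * (x ^+ (3 ^ r) - x) ^+ 2 =
     d * x ^+ 2 - (d * x ^+ 2) ^+ (3 ^ r)) ->
  esum t = gauss d * \sum_(c in Fix r) psi (- (c ^+ 2 / d)).
Proof.
move=> d0 H; have dr0 : d ^+ (3 ^ r) != 0 by rewrite expf_neq0.
transitivity (\sum_x psi (d ^+ (3 ^ r) * (x ^+ (3 ^ r) - x) ^+ 2)).
  apply: eq_bigr => x _; rewrite -[trinomial t x](subrK (d ^+ (3 ^ r) * (x ^+ (3 ^ r) - x) ^+ 2)).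
  rewrite H addcharD -[RHS]mul1r; congr (_ * _).
  by apply: addchar_trace0; rewrite traceB trace_frob subrr.
rewrite sum_addchar_pullback // gauss_frob; congr (_ * _).
apply: eq_bigr => c; rewrite inE => /eqP cE.
rewrite -[RHS](addchar_frob r) expr3nN exprMn exprVn.
by rewrite -exprM mulnC exprM cE.
Qed.

Lemma esum_pullback_small d : d != 0 ->
  esum (d + d ^+ 3, d ^+ 3, 0) = gauss d * \sum_(c in Fix 1) psi (- (c ^+ 2 / d)).
Proof.
move=> d0; apply: esum_pullback => // x; rewrite /trinomial /= expn1.
apply/eqP; rewrite -subr_eq0; apply/eqP.
transitivity (3%:R * (d ^+ 3 * x ^+ 4)); last by rewrite three0 mul0r.
by ring.
Qed.

Lemma esum_pullback_large d : d != 0 ->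
  esum (d + d ^+ 9, 0, d ^+ 9) = gauss d * \sum_(c in Fix 2) psi (- (c ^+ 2 / d)).
Proof.
move=> d0; apply: esum_pullback => // x; rewrite /trinomial /= -[(3 ^ 2)%N]/9%N exprMn.
apply/eqP; rewrite -subr_eq0; apply/eqP; move: (d ^+ 9) => e.
transitivity (3%:R * (e * x ^+ 10)); last by rewrite three0 mul0r.
by ring.
Qed.

(** Inverting [y ^+ 9 - y] preserves its Gauss sum and makes [sum_Fix_trivial] applicable, so
    [Fix 1] and [Fix 2] contribute the factors 3 and 9; [Fix 2] has 9 elements because [m] is
    even. *)
Lemma exists_esum_even (s : bool) (j : nat) : (j <= 2)%N ->
  exists2 t, t != 0 & esum t = (-1) ^+ s * (3 ^ (m./2 + j))%:R.
Proof.
have [y [y0 yG]] := gauss_both_signs s.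
have w0 : (y ^+ 9 - y)^-1 != 0 by rewrite invr_eq0.
have two_m : (2 %| m)%N by rewrite dvdn2.
move=> j2; have [->|->|->] : [\/ j = 0, j = 1 | j = 2]%N.
- by case: j j2 => [|[|[|]]] // _; [constructor 1|constructor 2|constructor 3].
- exists (y ^+ 9 - y, 0, 0); first by apply: contraNneq y0 => -[->].
  by rewrite esum_diag addn0.
- exists ((y ^+ 9 - y)^-1 + (y ^+ 9 - y)^-1 ^+ 3, (y ^+ 9 - y)^-1 ^+ 3, 0).
    by apply: contraNneq w0 => -[_ /eqP]; rewrite expf_eq0 /= => /eqP ->.
  rewrite (esum_pullback_small w0) invrK sum_Fix_trivial // (card_Fix g_prim) //.
  by rewrite gaussV // yG expnD natrM mulrA.
- exists ((y ^+ 9 - y)^-1 + (y ^+ 9 - y)^-1 ^+ 9, 0, (y ^+ 9 - y)^-1 ^+ 9).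
    by apply: contraNneq w0 => -[_ /eqP]; rewrite expf_eq0 /= => /eqP ->.
  rewrite (esum_pullback_large w0) invrK sum_Fix_trivial // (card_Fix g_prim) //.
  by rewrite gaussV // yG expnD natrM mulrA.
Qed.

(** Take [d = e^-1] with [tr e != 0]. Over [Fix 1], that is 0 and the two square roots of 1, the
    sums for [d] and [- d] are [1 + 2 psi (- e)] and [1 + 2 psi e]; they add up to 0, and the Gauss
    sums of [d] and [- d] agree. *)
Lemma exists_esum_odd : exists2 t, t != 0 & esum t + esum (- t) = 0.
Proof.
have [e] := trace_surj (oner_neq0 F); rewrite mul1r => te.
have e0 : e != 0 by apply: contraNneq te => ->; rewrite trace0.
have e0' : e^-1 != 0 by rewrite invr_eq0.
have sumE d : d != 0 ->
    \sum_(c in Fix 1) psi (- (c ^+ 2 / d)) = 1 + 2%:R * psi (- d^-1).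
  move=> d0; have F0 : 0 \in Fix 1 by rewrite inE expr0n.
  rewrite (bigD1 0) //= expr0n mul0r oppr0 addchar0; congr (_ + _).
  rewrite (eq_bigr (fun=> psi (- d^-1))) => [|c]; last first.
    rewrite inE expn1 => /andP[/eqP c3 c0]; congr (psi (- _)).
    suff -> : c ^+ 2 = 1 by rewrite mul1r.
    by apply: (mulfI c0); rewrite mulr1.
  rewrite sumr_const mulr_natl; congr (_ *+ _).
  have <- : #|[predD1 Fix 1 & 0]| = 2%N.
    have := card_Fix g_prim (isT : (0 < 1)%N) (dvd1n m).
    by rewrite (cardD1 0) F0 => -[].
  by apply: eq_card => c; rewrite unfold_in !inE andbC.
exists (e^-1 + e^-1 ^+ 3, e^-1 ^+ 3, 0).
  by apply: contraNneq e0' => -[_ /eqP]; rewrite expf_eq0 /= => /eqP ->.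
have -> : - (e^-1 + e^-1 ^+ 3, e^-1 ^+ 3, 0) = (- e^-1 + (- e^-1) ^+ 3, (- e^-1) ^+ 3, 0) :> F * F * F.
  by rewrite -[LHS]/(- (e^-1 + e^-1 ^+ 3), - e^-1 ^+ 3, - 0) oppr0 opprD (expr3nN 1).
rewrite !esum_pullback_small ?oppr_eq0 // !sumE ?oppr_eq0 //.
have [-> _] := gauss_oppE e0'; rewrite -mulrDr.
rewrite invrN opprK invrK.
have -> : 1 + 2%:R * psi (- e) + (1 + 2%:R * psi e) = 2%:R * (1 + (psi e + psi (- e))) by ring.
by rewrite addchar_sumN (negbTE te) mulr0 sub0r subrr !mulr0.
Qed.

End EvenDegree.

(** * Translation between weights and exponential sums *)

Lemma trinomial_weight0 : trinomial_weight 0 = 0%N.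
Proof.
apply/eqP; rewrite cards_eq0; apply/eqP/setP => x.
by rewrite !inE /trinomial /= !mul0r !addr0 trace0 eqxx.
Qed.

Definition central_weight : nat := (3 ^ (m - 1) * (3 - 1))%N.

(** The division by 3 is exact for [m >= 2], the one by 2 when [m + j] is even. *)
Definition weight_gap (j : nat) : nat := ((3 - 1) * 3 ^ ((m + j) %/ 2) %/ 3)%N.

Lemma central_weightE : (3 * central_weight = 2 * q)%N.
Proof. by rewrite /central_weight mulnA -expnS subn1 prednK // cardF mulnC. Qed.

Lemma weight_gapE j : (2 <= m)%N -> (3 * weight_gap j = 2 * 3 ^ ((m + j) %/ 2))%N.
Proof.
move=> m2; rewrite /weight_gap mulnC divnK // dvdn_mull //.
by rewrite dvdn_exp // divn_gt0 // ltn_addr.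
Qed.

(** If [esum (- t) = - esum t], then [esum t] has negative square, so both sides are false. The
    right side depends only on the weight. *)
Lemma esum_eq_real t (n : int) : t != 0 -> n != 0 ->
  (esum t == n%:~R) = (esum t + esum (- t) == 2%:R * n%:~R).
Proof.
move=> t0 n0; have two0 : 2%:R != 0 :> K by rewrite pnatr_eq0.
have [k _ [SS]] := esum_cases t0.
case: ifP => _; last by case=> -> _; rewrite -mulr2n -[esum t *+ 2]mulr_natl (inj_eq (mulfI two0)).
move=> SN; rewrite SN subrr eq_sym [RHS]eq_sym mulf_eq0 (negbTE two0) intr_eq0 (negbTE n0).
apply/negP => /eqP Sn; move: SS; rewrite SN -Sn mulrN -expr2 => SS.
have : 0 <= n%:~R ^+ 2 :> K by rewrite -rmorphXn ler0z sqr_ge0.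
by rewrite -[X in 0 <= X]opprK SS oppr_ge0 lern0 expn_eq0.
Qed.

Section EvenDegreeWeights.
Hypotheses (m_even : ~~ odd m) (m_ge6 : (6 <= m)%N).

(** Thus [central_weight - weight_gap j] is a true subtraction with a positive value. *)
Lemma weight_gap_lt j : (j <= 4)%N -> (weight_gap j < central_weight)%N.
Proof.
move=> j4; have m2 : (2 <= m)%N by apply: leq_trans m_ge6.
rewrite -(ltn_pmul2l (m := 3)) // weight_gapE // central_weightE ltn_pmul2l // cardF.
by rewrite ltn_exp2l // ltn_divLR // muln2 -addnn ltn_add2l (leq_ltn_trans j4) // ltnW.
Qed.

Lemma weight_gap_inj i j : ~~ odd i -> ~~ odd j ->
  (weight_gap i == weight_gap j) = (i == j).
Proof.
move=> ei ej; have m2 : (2 <= m)%N by apply: leq_trans m_ge6.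
rewrite -(eqn_pmul2l (m := 3)) // !weight_gapE // eqn_pmul2l // eqn_exp2l //.
rewrite -(eqn_pmul2r (m := 2)) // !divnK ?eqn_add2l // dvdn2 oddD.
  by rewrite (negbTE m_even).
by rewrite (negbTE m_even).
Qed.

(** Real sums satisfy [3 wt = 2q - 2S], so a negative sum ([e = true]) raises the weight. Both
    candidate weights are positive, which rules out [t = 0]. *)
Lemma weight_evenE t (e : bool) j : (j <= 4)%N ->
  (trinomial_weight t == if e then central_weight + weight_gap j
                               else central_weight - weight_gap j)%N =
  (t != 0) && (esum t == (-1) ^+ e * (3 ^ ((m + j) %/ 2))%:R).
Proof.
move=> j4; have m2 : (2 <= m)%N by apply: leq_trans m_ge6.
have lt := weight_gap_lt j4.
have [->|t0] := eqVneq t 0.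
  by rewrite trinomial_weight0; case: e => /=; apply/negbTE; lia.
have := weight_gapE j m2; have := central_weightE.
set Q := (3 ^ _)%N; have Q0 : (0 < Q)%N by rewrite expn_gt0.
have -> : (-1) ^+ e * Q%:R = ((-1) ^+ e * Q%:Z)%:~R :> K.
  by rewrite rmorphM rmorphXn rmorphN1.
rewrite /= esum_eq_real // ?mulf_eq0 ?signr_eq0 -?lt0n // esum_add_opp.
rewrite -[2%:R]/((2 : int)%:~R) -[3%:R]/((3 : int)%:~R) -[q%:R]/(q%:Z%:~R).
rewrite -[(trinomial_weight t)%:R]/((trinomial_weight t)%:Z%:~R) -!rmorphM -rmorphB /=.
rewrite (eqr_int K); move: (trinomial_weight t) lt => w lt wq gq.
by case: e; rewrite ?expr0 ?expr1; lia.
Qed.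

Lemma weight_centralE t :
  (trinomial_weight t == central_weight) = (t != 0) && (esum t + esum (- t) == 0).
Proof.
have lt := @weight_gap_lt 0 isT.
have [->|t0] := eqVneq t 0; first by rewrite trinomial_weight0; lia.
by rewrite /= esum_add_opp subr_eq0 -!natrM eqr_nat -central_weightE eqn_pmul2l // eq_sym.
Qed.

Definition code_weights : seq nat :=
  let w0 := central_weight in let d := weight_gap in
  [:: w0; w0 - d 0; w0 + d 0; w0 - d 2; w0 + d 2; w0 - d 4; w0 + d 4]%N.

Lemma weight_cases t : t != 0 -> trinomial_weight t \in code_weights.
Proof.
move=> t0; have [k k4 [_]] := esum_cases t0.
rewrite oddD (negbTE m_even) /=; case: ifP => ok E.
  by rewrite inE weight_centralE t0 E subrr eqxx.
rewrite -divn2 in E; have [e] : exists e : bool, esum t = (-1) ^+ e * (3 ^ ((m + k) %/ 2))%:R.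
  by case: E => _ [] ->; [exists false; rewrite mul1r | exists true; rewrite mulN1r].
move/eqP; rewrite -[_ == _]andTb -{1}t0 -(weight_evenE _ _ k4) => /eqP ->.
by move: k k4 ok {E} => [|[|[|[|[|]]]]] //= _ _; case: e; rewrite !inE eqxx ?orbT.
Qed.

(** This yields injectivity of the encoding, so that codewords can be counted by triples. *)
Lemma trinomial_weight_gt0 t : t != 0 -> (0 < trinomial_weight t)%N.
Proof.
move/weight_cases.
have [l0 l2 l4] := And3 (@weight_gap_lt 0 isT) (@weight_gap_lt 2 isT) (@weight_gap_lt 4 isT).
by rewrite !inE; lia.
Qed.

End EvenDegreeWeights.
End ExponentialSums.

(** * From triples to codewords *)

Section TraceCode.
Variables (F : finFieldType) (pcharF : 3%N \in [pchar F]).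
Variables (g : F) (g_prim : (#|F|.-1).-primitive_root g).

Definition word (t : F * F * F) := trace_codeword pcharF g t.1.1 t.1.2 t.2.

Lemma wordE t i : word t 0 i = trace pcharF (trinomial t (g ^+ i)).
Proof. by rewrite mxE /trinomial -!exprM !(mulnC i). Qed.

Lemma prim_root_log x : x != 0 -> exists i : 'I_(#|F|.-1), x = g ^+ i.
Proof. by move=> /expf_card_pred/(prim_rootP g_prim)[i ->]; exists i. Qed.

(** The powers of [g] run once through the nonzero elements, and [x = 0] adds nothing because the
    trinomial vanishes there. *)
Lemma hamming_weight_word t : hamming_weight (word t) = trinomial_weight pcharF t.
Proof.
have g_inj : injective (fun i : 'I_(#|F|.-1) => g ^+ i).
  move=> i j /= /eqP; rewrite (eq_prim_root_expr g_prim) !modn_small // => /eqP.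
  exact: val_inj.
rewrite /hamming_weight -(card_imset _ g_inj); apply: eq_card => x.
rewrite !inE; apply/imsetP/idP => [[i +]|xt].
  by rewrite inE wordE => it ->.
have x0 : x != 0 by apply: contraNneq xt => ->; rewrite trinomial0 trace0.
by have [i xE] := prim_root_log x0; exists i; rewrite // inE wordE -xE.
Qed.

Lemma word_inj : (forall t, t != 0 -> (0 < trinomial_weight pcharF t)%N) -> injective word.
Proof.
move=> wt t u tu; apply/eqP; rewrite -subr_eq0; apply: contraTT isT => /wt.
rewrite card_gt0 => /set0Pn[x]; rewrite inE trinomialB traceB subr_eq0.
have [->|/prim_root_log[i ->]] := eqVneq x 0; first by rewrite !trinomial0 eqxx.
by rewrite -!wordE tu eqxx.
Qed.

Lemma weight_count_word w : injective word ->
  weight_count [set word t | t : F * F * F] w = #|[set t | trinomial_weight pcharF t == w]|.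
Proof.
move=> w_inj; rewrite /weight_count -(card_imset _ w_inj); apply: eq_card => v.
rewrite !inE; apply/andP/imsetP => [[/imsetP[t _ ->]]|[t]].
  by rewrite hamming_weight_word => wt; exists t; rewrite ?inE.
by rewrite inE => wt ->; rewrite imset_f ?hamming_weight_word.
Qed.

End TraceCode.

Lemma mem_nonzero_weights (K : finNzRingType) l (C : {set 'rV[K]_l}) w :
  (w \in nonzero_weights C) = (w != 0%N) && (0 < weight_count C w)%N.
Proof.
rewrite mem_undup; apply/mapP/andP => [[v] | [w0 /card_gt0P[v]]].
  rewrite mem_filter mem_enum => /andP[v0 vC] ->; split=> //.
  by apply/card_gt0P; exists v; rewrite inE vC eqxx.
by rewrite inE => /andP[vC /eqP vw]; exists v; rewrite // mem_filter mem_enum vC vw w0.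
Qed.

(** * The cube root of unity and the absolute values in [R[i]] *)

Section CubeRootOfUnity.
Variable R : realType.
Local Open Scope complex_scope.

Definition cube_root : R[i] := cos (2 * pi / 3%:R) +i* sin (2 * pi / 3%:R).

Lemma cube_rootP : cube_root ^+ 2 + cube_root + 1 = 0.
Proof.
pose th : R := 2 * pi / 3%:R.
have zk k : cube_root ^+ k = cos (th *+ k) +i* sin (th *+ k).
  elim: k => [|k IHk]; first by rewrite mulr0n cos0 sin0.
  rewrite exprSr IHk mulrSr cosD sinD /cube_root -/th.
  by apply/eqP; rewrite eq_complex /= eqxx addrC eqxx.
have th3 : th *+ 3 = pi *+ 2.
  by rewrite -[th *+ 3]mulr_natr /th divfK ?pnatr_eq0 // mulr_natl.
have z3 : cube_root ^+ 3 = 1 by rewrite zk th3 cos2pi sin2pi.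
(* The imaginary part is [sin (2 pi / 3) > 0]. *)
have z1 : cube_root - 1 != 0.
  rewrite subr_eq0 eq_complex negb_and /= orbC gt_eqF //.
  rewrite sin_gt0_pi //; have := pi_gt0 R; lra.
apply: (mulfI z1); rewrite mulr0.
transitivity (cube_root ^+ 3 - 1); first by ring.
by rewrite z3 subrr.
Qed.

Lemma exp_sumE (F : finFieldType) (pcharF : 3%N \in [pchar F]) t :
  exp_sum pcharF R t = esum pcharF cube_root t.
Proof. by case: t => [[a b] c]. Qed.

Definition amplitude (n : nat) : R[i] := (3%:R `^ (n%:R / 2))%:C.

Lemma amplitude_even n : ~~ odd n -> amplitude n = (3 ^ (n %/ 2))%:R.
Proof.
move=> en; rewrite /amplitude -{1}(divnK (m := n) (d := 2)) ?dvdn2 //.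
by rewrite natrM mulfK ?pnatr_eq0 // powR_mulrn // rmorphXn /= natrX rmorph_nat.
Qed.

Lemma sqr_amplitude n : amplitude n ^+ 2 = (3 ^ n)%:R.
Proof.
rewrite /amplitude -rmorphXn /= -powR_mulrn ?powR_ge0 // -powRrM.
by rewrite divfK ?pnatr_eq0 // powR_mulrn // rmorphXn /= rmorph_nat natrX.
Qed.

End CubeRootOfUnity.

(** * Frequencies of the weights *)

Section Frequencies.
Variables (R : realType) (F : finFieldType) (pcharF : 3%N \in [pchar F]).
Variables (m : nat) (cardF : #|F| = (3 ^ m)%N) (m_ge6 : (6 <= m)%N) (m_even : ~~ odd m).

Local Notation n := (num_exp_sum pcharF R m).
Local Notation zP := (cube_rootP R).

Lemma num_exp_sum_even (e : bool) j : (j <= 4)%N -> ~~ odd j ->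
  #|[set t | trinomial_weight pcharF t ==
       if e then central_weight m + weight_gap m j
            else central_weight m - weight_gap m j]%N| = n ((-1) ^+ e) j.
Proof.
move=> j4 ej; apply: eq_card => t; rewrite !inE.
rewrite (weight_evenE pcharF cardF zP) // -exp_sumE (negbTE ej) mulr1.
by rewrite -/(amplitude R (m + j)) amplitude_even ?oddD ?(negbTE m_even) // rmorphXn rmorphN1.
Qed.

(** Central weight means that the sum is one of the four distinct numbers [r 1], [- r 1], [r 3],
    [- r 3]; conjugation makes the two signs equally frequent. *)
Lemma num_exp_sum_central :
  #|[set t | trinomial_weight pcharF t == central_weight m]| = (2 * (n 1 1 + n 1 3))%N.
Proof.
pose S := esum pcharF (cube_root R); pose r j := 'i%C * amplitude R (m + j).
have i2 : 'i%C ^+ 2 = -1 :> R[i] by exact: sqr_i.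
have r2 j : r j ^+ 2 = - (3 ^ (m + j))%:R by rewrite exprMn i2 sqr_amplitude mulN1r.
have r_neq j : r j != - r j.
  rewrite -addr_eq0 -mulr2n mulrn_eq0 /= -sqrf_eq0 r2 oppr_eq0 pnatr_eq0.
  by rewrite expn_eq0.
have nE eps j : odd j -> n eps j = #|[set t : F * F * F | (t != 0) && (S t == eps%:~R * r j)]|.
  by move=> oj; apply: eq_card => t; rewrite !inE exp_sumE oj -mulrA.
have key : #|[set t | trinomial_weight pcharF t == central_weight m]| =
    ((n 1 1 + n (-1) 1) + (n 1 3 + n (-1) 3))%N.
  rewrite !nE // -!sum1dep_card ![\sum_(t | _) 1%N]big_mkcond -!big_split.
  apply: eq_bigr => t _ /=; rewrite (weight_centralE pcharF cardF zP) //.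
  have [//|t0] := eqVneq t 0; rewrite /= !mulN1r !mul1r -/S.
  have [k k4 [SS]] := esum_cases pcharF cardF zP t0; rewrite -/S in SS *.
  rewrite oddD (negbTE m_even) /=; case: ifP => ok E; last first.
    case: E => E _; rewrite E -expr2 in SS *.
    have St0 : S t != 0 by rewrite -sqrf_eq0 SS pnatr_eq0 expn_eq0.
    rewrite -mulr2n mulrn_eq0 (negbTE St0) /=.
    (* Here [S t] has positive square, [r j] negative square. *)
    have Sr j : (S t == r j) || (S t == - r j) = false.
      rewrite -eqf_sqr SS r2 -addr_eq0 -natrD pnatr_eq0 addn_eq0.
      by rewrite !expn_eq0.
    by have := (Sr 1%N, Sr 3); do 2!case: eqP => _ //=; do 2!case: eqP => _ //=; case.
  rewrite E subrr eqxx; rewrite E mulrN -expr2 in SS.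
  have S2 : S t ^+ 2 = - (3 ^ (m + k))%:R by rewrite -SS opprK.
  have Sr j : (S t == r j) || (S t == - r j) = (k == j).
    by rewrite -eqf_sqr S2 r2 eqr_opp eqr_nat eqn_exp2l // eqn_add2l.
  have Sr1 j : (S t == r j) && (S t == - r j) = false.
    by apply: contraNF (r_neq j) => /andP[/eqP <- /eqP <-].
  have : k \in [:: 1; 3]%N by move: k k4 ok {SS E S2 Sr} => [|[|[|[|[|]]]]].
  rewrite !inE => /orP[] /eqP kE; move: (Sr 1%N) (Sr 3) (Sr1 1%N) (Sr1 3); rewrite kE /=;
    by move: (S t == r 1%N) (S t == - r 1%N) (S t == r 3) (S t == - r 3) => [] [] [] [].
rewrite key -!(@num_exp_sum_odd _ _ pcharF R m 1) //; lia.
Qed.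

End Frequencies.

Theorem theorem1 (R : realType) (F : finFieldType) (pcharF : 3%N \in [pchar F])
    (m : nat) (cardF : #|F| = (3 ^ m)%N) (m_ge6 : (6 <= m)%N) (m_even : ~~ odd m)
    (g : F) (g_prim : (#|F|.-1).-primitive_root g) :
  let C := cyclic_code pcharF [:: g ^- 2; g ^- (3 + 1); g ^- (3 ^ 2 + 1)] in
  let A := weight_count C in
  let n := num_exp_sum pcharF R m in
  let w0 := (3 ^ (m - 1) * (3 - 1))%N in
  let d := fun j => ((3 - 1) * 3 ^ ((m + j) %/ 2) %/ 3)%N in
  perm_eq (nonzero_weights C)
    [:: w0; w0 - d 0; w0 + d 0; w0 - d 2; w0 + d 2; w0 - d 4; w0 + d 4]%N /\
  [/\ A w0 = (2 * (n 1%R 1 + n 1%R 3))%N,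
      A (w0 - d 0)%N = n 1 0%N /\ A (w0 + d 0)%N = n (-1) 0%N,
      A (w0 - d 2)%N = n 1 2%N /\ A (w0 + d 2)%N = n (-1) 2%N &
      A (w0 - d 4)%N = n 1 4%N /\ A (w0 + d 4)%N = n (-1) 4%N].
Proof.
move=> C A n w0 d; have zP := cube_rootP R.
have wt0 := trinomial_weight_gt0 pcharF cardF zP m_even m_ge6.
have AE w : A w = #|[set t | trinomial_weight pcharF t == w]|.
  rewrite /A /C (cyclic_code_trace pcharF cardF) //; apply: (weight_count_word g_prim).
  exact: (word_inj g_prim wt0).
have AP w t : trinomial_weight pcharF t = w -> (0 < A w)%N.
  by rewrite AE => tw; apply/card_gt0P; exists t; rewrite inE tw.
have Aeven (e : bool) j : (j <= 2)%N ->
    (0 < A (if e then w0 + d j.*2 else w0 - d j.*2))%N.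
  move=> j2; have [t t0 St] := exists_esum_even pcharF cardF zP m_even m_ge6 g_prim e j2.
  apply: (AP _ t); apply/eqP; rewrite (weight_evenE pcharF cardF zP m_even m_ge6).
    by rewrite t0 St divn2 halfD (negbTE m_even) doubleK add0n eqxx.
  by rewrite (leq_double _ 2).
have Acentral : (0 < A w0)%N.
  have [t t0 St] := exists_esum_odd pcharF cardF zP m_even g_prim.
  by apply: (AP _ t); apply/eqP; rewrite (weight_centralE pcharF cardF zP) // t0 St eqxx.
have AnE (e : bool) j : (j <= 4)%N -> ~~ odd j ->
    A (if e then w0 + d j else w0 - d j)%N = n ((-1) ^+ e) j.
  by move=> j4 oj; rewrite AE (num_exp_sum_even R pcharF cardF m_ge6 m_even e j4 oj).
split; last first.
  split; first by rewrite AE (num_exp_sum_central R pcharF cardF m_ge6 m_even).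
  - by split; [apply: (AnE false 0%N) | apply: (AnE true 0%N)].
  - by split; [apply: (AnE false 2%N) | apply: (AnE true 2%N)].
  - by split; [apply: (AnE false 4%N) | apply: (AnE true 4%N)].
have d_lt j : (j <= 4)%N -> (d j < w0)%N := @weight_gap_lt F m cardF m_ge6 j.
have d_gt0 j : (0 < d j)%N.
  have : (3 * d j = 2 * 3 ^ ((m + j) %/ 2))%N by apply: weight_gapE; apply: leq_trans m_ge6.
  by have := expn_gt0 3 ((m + j) %/ 2); lia.
have d_neq i j : ~~ odd i -> ~~ odd j -> i != j -> d i != d j.
  by move=> oi oj; rewrite (weight_gap_inj m_even m_ge6 oi oj).
have l0 := d_lt 0%N isT; have l2 := d_lt 2%N isT; have l4 := d_lt 4%N isT.
(* Both lists are duplicate-free, so it remains to compare their members. *)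
apply: uniq_perm; first exact: undup_uniq.
  have n02 := d_neq 0%N 2%N isT isT isT; have n04 := d_neq 0%N 4%N isT isT isT.
  have n24 := d_neq 2%N 4%N isT isT isT.
  have U (w a b c : nat) : (0 < a -> 0 < b -> 0 < c -> a < w -> b < w -> c < w ->
      a != b -> a != c -> b != c ->
      uniq [:: w; w - a; w + a; w - b; w + b; w - c; w + c])%N.
    by move=> *; rewrite /= !inE !negb_or; repeat (apply/andP; split); lia.
  exact: (U _ _ _ _ (d_gt0 _) (d_gt0 _) (d_gt0 _)).
move=> w; rewrite mem_nonzero_weights; apply/idP/idP => [/andP[w0' Aw]|].
  move: Aw; rewrite -/A AE => /card_gt0P[t]; rewrite inE => /eqP tw; rewrite -tw.
  apply: (weight_cases pcharF cardF zP m_even m_ge6).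
  by apply: contraNneq w0' => t0; rewrite -tw t0 trinomial_weight0.
have evenP (e : bool) j v : (j <= 2)%N ->
    v = (if e then w0 + d j.*2 else w0 - d j.*2)%N -> (v != 0%N) && (0 < A v)%N.
  move=> j2 ->; rewrite (Aeven e j j2) andbT.
  have lt : (d j.*2 < w0)%N by apply: d_lt; rewrite (leq_double j 2).
  by case: (e); rewrite -lt0n ?subn_gt0 // ltn_addr // (leq_ltn_trans _ lt).
case/predU1P => [->|]; first by rewrite -/A Acentral andbT -lt0n (leq_ltn_trans _ l0).
case/predU1P => [->|]; first exact: (evenP false 0%N _ isT erefl).
case/predU1P => [->|]; first exact: (evenP true 0%N _ isT erefl).
case/predU1P => [->|]; first exact: (evenP false 1%N _ isT erefl).
case/predU1P => [->|]; first exact: (evenP true 1%N _ isT erefl).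
case/predU1P => [->|]; first exact: (evenP false 2%N _ isT erefl).
by case/predU1P => [->|//]; exact: (evenP true 2%N _ isT erefl).
Qed.
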